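(* Let $\ell_1,\ell_2$ be positive integers with $(\ell_1,\ell_2)\notin\{(1,1),(1,2),(2,1),(1,3),(3,1)\}$. Let $\mathcal{P}_{\ell_1,\ell_2}$ be the set of primitive vectors $(a,b)\in\mathbb{Z}^2$ lying strictly in the first quadrant that are permissible for $(\ell_1,\ell_2)$. Then $\mathcal{P}_{\ell_1,\ell_2}$ is the disjoint union $$\mathcal{P}_{\ell_1,\ell_2}=\mathcal{A}^*_{\ell_1,\ell_2}\ \cup\ \mathcal{B}^*_{\ell_1,\ell_2}\ \cup\ \Big\{(a,b)\in\mathbb{Z}^2 \text{ primitive, } a,b>0\ \Big|\ \xi_-\le \frac{b}{a}\le \xi_+\Big\}.$$
   Context: A vector $(a,b)\in\mathbb{Z}^2$ is primitive if it is not divisible in $\mathbb{Z}^2$ (equivalently $\gcd(a,b)=1$); it lies strictly in the first quadrant if $a>0$ and $b>0$. An ordered partition $\mathbf{P}=p_1+\cdots+p_\ell$ of length $\ell$ is a sequence of $\ell$ non-negative integers (zero parts allowed, order matters); its size $|\mathbf{P}|$ is the sum of its parts. A primitive vector $(a,b)$ strictly in the first quadrant is permissible for $(\ell_1,\ell_2)$ if there exist an integer $k>0$ and ordered partitions $\mathbf{P}_a=p_1+\cdots+p_{\ell_1}$ of size $ak$ and $\mathbf{P}_b=p'_1+\cdots+p'_{\ell_2}$ of size $bk$ such that $$abk^2-k-\sum_{i=1}^{\ell_1}p_i^2-\sum_{j=1}^{\ell_2}(p'_j)^2+2\ \ge 0.$$ Let $R_{\ell_1,\ell_2}(z)=\frac{1}{\ell_2}z^2-z+\frac{1}{\ell_1}$,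 so $a^2R_{\ell_1,\ell_2}(b/a)=\frac{a^2}{\ell_1}-ab+\frac{b^2}{\ell_2}$. For the pairs considered its roots are real: $$\xi_\pm=\frac{\ell_2}{2}\left(1\pm\sqrt{1-\frac{4}{\ell_1\ell_2}}\right).$$ $\mathcal{A}^*_{\ell_1,\ell_2}$ is the set of $(a,b)\in\mathbb{Z}^2$ strictly in the first quadrant with $a\equiv\pm1 \bmod \ell_1$, $b\equiv 0\bmod \ell_2$ and $a^2R_{\ell_1,\ell_2}(b/a)=\frac{1}{\ell_1}$. $\mathcal{B}^*_{\ell_1,\ell_2}$ is the set of $(a,b)\in\mathbb{Z}^2$ strictly in the first quadrant with $a\equiv 0\bmod \ell_1$, $b\equiv\pm1\bmod\ell_2$ and $a^2R_{\ell_1,\ell_2}(b/a)=\frac{1}{\ell_2}$. *)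

(* Defs.v *)
From mathcomp Require Export all_boot all_order all_algebra.
From mathcomp Require Export classical_sets reals.

Set Implicit Arguments.
Unset Strict Implicit.
Unset Printing Implicit Defensive.

Import Order.TTheory GRing.Theory Num.Theory.

Local Open Scope ring_scope.
Local Open Scope classical_set_scope.

Definition primitive (v : int * int) : Prop := coprimez v.1 v.2.

Definition in_first_quadrant (v : int * int) : Prop := 0 < v.1 /\ 0 < v.2.

(* An ordered partition of length l is an [l.-tuple nat]: order matters and
   zero parts are allowed. *)
Definition part_size (l : nat) (P : l.-tuple nat) : nat :=
  (\sum_(p <- P) p)%N.

Definition permissible (l1 l2 : nat) (v : int * int) : Prop :=
  exists k : int, 0 < k /\
  exists (Pa : l1.-tuple nat) (Pb : l2.-tuple nat),
    (part_size Pa)%:Z = v.1 * k /\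
    (part_size Pb)%:Z = v.2 * k /\
    0 <= v.1 * v.2 * k ^+ 2 - k - \sum_(p <- Pa) p%:Z ^+ 2
         - \sum_(p <- Pb) p%:Z ^+ 2 + 2.

Definition permissible_vectors (l1 l2 : nat) : set (int * int) :=
  [set v | primitive v /\ in_first_quadrant v /\ permissible l1 l2 v].

Section RealDefs.
Variables (R : realType) (l1 l2 : nat).

Definition Rquad (z : R) : R := l2%:R^-1 * z ^+ 2 - z + l1%:R^-1.

(* [Num.sqrt] is 0 on negative arguments, so these are the roots of [Rquad]
   only when 4 <= l1 * l2. *)
Definition xi_minus : R :=
  l2%:R / 2 * (1 - Num.sqrt (1 - 4 / (l1%:R * l2%:R))).

Definition xi_plus : R :=
  l2%:R / 2 * (1 + Num.sqrt (1 - 4 / (l1%:R * l2%:R))).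

Definition slope (v : int * int) : R := v.2%:~R / v.1%:~R.

Definition Astar : set (int * int) :=
  [set v | in_first_quadrant v /\
     ((v.1 = 1 %[mod l1%:Z])%Z \/ (v.1 = -1 %[mod l1%:Z])%Z) /\
     (v.2 = 0 %[mod l2%:Z])%Z /\
     v.1%:~R ^+ 2 * Rquad (slope v) = l1%:R^-1].

Definition Bstar : set (int * int) :=
  [set v | in_first_quadrant v /\
     (v.1 = 0 %[mod l1%:Z])%Z /\
     ((v.2 = 1 %[mod l2%:Z])%Z \/ (v.2 = -1 %[mod l2%:Z])%Z) /\
     v.1%:~R ^+ 2 * Rquad (slope v) = l2%:R^-1].

Definition between_roots : set (int * int) :=
  [set v | primitive v /\ in_first_quadrant v /\
     xi_minus <= slope v <= xi_plus].

End RealDefs.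

(* Main.v *)
Require Import Defs.
From mathcomp Require Import all_boot all_order all_algebra.
From mathcomp Require Import classical_sets reals.
From mathcomp Require Import ring lra zify.
Import Order.TTheory GRing.Theory Num.Theory.
Local Open Scope classical_set_scope.
Local Open Scope ring_scope.

(** Write [D(a, b) = l2 a^2 - l1 l2 a b + l1 b^2], the integer [l1 l2] times
    [a^2 R(b/a)].  Everything is decided by the sign of [D]: as [l1 l2 >= 4],
    the slope [b/a] lies between the two roots exactly when [D <= 0]
    ([between_rootsP]).

    A partition of [N] into [l] parts has sum of squares at least
    [(N^2 + r (l - r)) / l], where [r] is the residue of [N] modulo [l]
    ([partition_sum_sqr_ge]), and parts as equal as possible attain this bound;
    only the residues 0, 1 and [l - 1] are needed for attainment
    ([near_constant_partition]).  Hence [(a, b)] is permissible exactly when for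
    some [k > 0], with [r] and [s] the residues of [a k] and [b k],
    [k^2 D + l2 r (l1 - r) + l1 s (l2 - s) <= l1 l2 (2 - k)].

    If [D < 0], then [k = l1 l2] works, since [r = s = 0] and [D <= -1].  If
    [D = 0], the discriminant [n^2 - 4 n] of the form, [n = l1 l2], is a perfect
    square, which forces [n = 4] and then [2 a = l1 b], [2 b = l2 a], so that
    [k = 2] works with constant partitions ([permissible_disc_form_le0]).

    If [D > 0], then [k = 1] ([permissible_cases]).  Both residues cannot be
    nonzero, because then [r (l1 - r) >= l1 - 1] and [s (l2 - s) >= l2 - 1],
    with [l1, l2 >= 2].  If only [r] is nonzero, the inequality gives [r = 1] or
    [r = l1 - 1] and [D = l2], that is [(a, b)] is in the set A*; symmetrically
    for [s] and B*.  If both vanish, then [a = l1 x], [b = l2 y] with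
    [l1 x^2 - l1 l2 x y + l2 y^2 = 1], which has no positive solution when
    [l1, l2 >= 2], by Vieta jumping ([no_unit_value]); when one of [l1], [l2]
    is 1, the vector is in A* or B* because the congruence modulo 1 is void.
    Conversely, the vectors of A* and B* are permissible with [k = 1], and the
    equation [D = l2] or [D = l1] is itself a Bezout relation
    ([boundary_vector_coprime]).  The sign of [D] separates A* and B* from the
    third set, and a common element of A* and B* would give [l1 = l2 = 1]. *)

(** * Sums of squares of the parts of a partition *)

(** For integers [p] and [q], the number [p^2] lies on or above the chord of the
    parabola through [q] and [q + 1]; this is the sum over the parts. *)
Lemma sum_sqr_chord (q : int) (s : seq nat) :
  (2 * q + 1) * (\sum_(p <- s) p)%N%:Z - (size s)%:Z * (q * (q + 1))
    <= \sum_(p <- s) p%:Z ^+ 2.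
Proof.
elim: s => [|x s IHs] /=; first by rewrite !big_nil; lia.
rewrite !big_cons.
have hx : 0 <= (x%:Z - q) * (x%:Z - q - 1).
  have [hxq|hxq] := leP x%:Z q; last by rewrite mulr_ge0 //; lia.
  by rewrite mulr_le0 //; lia.
move: IHs; set A := (\sum_(p <- s) p)%N; set B := \sum_(p <- s) p%:Z ^+ 2 => IHs.
rewrite PoszD; nia.
Qed.

Lemma partition_sum_sqr_ge (l : nat) (P : l.-tuple nat) : (0 < l)%N ->
  exists (q : int) (r : nat), (r < l)%N /\
    (part_size P)%:Z = q * l%:Z + r%:Z /\
    (part_size P)%:Z ^+ 2 + r%:Z * (l%:Z - r%:Z)
      <= l%:Z * \sum_(p <- P) p%:Z ^+ 2.
Proof.
move=> l0; set N := part_size P.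
have := @sum_sqr_chord (N %/ l)%N%:Z P; rewrite size_tuple -/(part_size P) -/N.
set S := \sum_(_ <- P) _ => hS.
exists (N %/ l)%N%:Z, (N %% l)%N; split; first exact: ltn_pmod.
have := divn_eq N l; move: (N %/ l)%N (N %% l)%N hS => q r hS hN.
have {}hN : N%:Z = q%:Z * l%:Z + r%:Z by rewrite {1}hN PoszD PoszM.
split=> //; have := ler_wpM2l (isT : 0 <= l%:Z) hS.
rewrite hN; lia.
Qed.

(** One part [q + e] and all the others [q].  The sum of squares is minimal for
    [e] among [0], [1], [-1], the only cases needed. *)
Lemma near_constant_partition (l : nat) (N e : int) (q : int) :
  (0 < l)%N -> 0 <= q -> 0 <= q + e -> N = q * l%:Z + e ->
  exists P : l.-tuple nat, (part_size P)%:Z = N /\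
    l%:Z * \sum_(p <- P) p%:Z ^+ 2 = N ^+ 2 + e ^+ 2 * (l%:Z - 1).
Proof.
case: l => // l _ q0 qe0 ->.
exists [tuple of absz (q + e) :: nseq l (absz q)].
have sum_const m : (\sum_(p <- nseq m (absz q)) p)%N%:Z = m%:Z * q.
  by elim: m => [|m IHm] /=; rewrite ?big_nil ?big_cons; lia.
have sum_const2 m : \sum_(p <- nseq m (absz q)) p%:Z ^+ 2 = m%:Z * q ^+ 2.
  elim: m => [|m IHm] /=; rewrite ?big_nil ?big_cons; first lia.
  rewrite IHm gez0_abs //; lia.
rewrite /part_size !big_cons PoszD sum_const sum_const2 !gez0_abs //; split; lia.
Qed.

(** * Arithmetic of the quadratic form *)

(** The integral form [l1 l2 a^2 R(b/a)]. *)
Definition disc_form (l1 l2 : nat) (a b : int) : int :=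
  l2%:Z * a ^+ 2 - l1%:Z * l2%:Z * a * b + l1%:Z * b ^+ 2.

Lemma disc_formC l1 l2 a b : disc_form l1 l2 a b = disc_form l2 l1 b a.
Proof. rewrite /disc_form; ring. Qed.

Lemma factors_gt0 (m n : nat) : (4 <= m * n)%N -> (0 < m)%N /\ (0 < n)%N.
Proof.
by move=> h; split; rewrite lt0n; apply: contraTneq h => ->; rewrite ?muln0.
Qed.

(** Vieta jumping: replacing [b] by the other root [l1 a - b], or [a] by
    [l2 b - a], keeps the value 1 and, as [l1, l2 >= 2], the positivity.  When
    neither replacement decreases the vector, the value is nonpositive. *)
Lemma no_unit_value (l1 l2 : nat) (a b : int) :
  (1 < l1)%N -> (1 < l2)%N -> 0 < a -> 0 < b ->
  l1%:Z * a ^+ 2 - l1%:Z * l2%:Z * a * b + l2%:Z * b ^+ 2 != 1.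
Proof.
move=> l11 l21 a0 b0; have [n] := ubnP (`|a| + `|b|)%N.
elim: n => // n IHn in a b a0 b0 *; move=> hn; apply/eqP => h.
have c1 : 0 < l1%:Z * a - b.
  have : 0 < l2%:Z * b * (l1%:Z * a - b) by nia.
  by rewrite pmulr_rgt0 //; nia.
have c2 : 0 < l2%:Z * b - a.
  have : 0 < l1%:Z * a * (l2%:Z * b - a) by nia.
  by rewrite pmulr_rgt0 //; nia.
have [d1|d1] := ltP (l1%:Z * a - b) b.
  by have /eqP[] := IHn _ _ a0 c1 ltac:(lia); rewrite -h; ring.
have [d2|d2] := ltP (l2%:Z * b - a) a.
  by have /eqP[] := IHn _ _ c2 b0 ltac:(lia); rewrite -h; ring.
have e1 : l2%:Z * b * (2 * b) <= l2%:Z * b * (l1%:Z * a).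
  by rewrite ler_wpM2l; nia.
have e2 : l1%:Z * a * (2 * a) <= l1%:Z * a * (l2%:Z * b).
  by rewrite ler_wpM2l; nia.
lia.
Qed.

(** An isotropic vector makes [n^2 - 4 n] a square, [n = l1 l2], while
    [(n - 3)^2 < n^2 - 4 n < (n - 2)^2] for [n > 4]. *)
Lemma disc_form_eq0 (l1 l2 : nat) (a b : int) :
  (4 <= l1 * l2)%N -> 0 < a ->
  disc_form l1 l2 a b = 0 -> (l1 * l2 = 4)%N.
Proof.
rewrite /disc_form => n4 a0 h.
set n := (l1 * l2)%N%:Z.
(* Completing the square: [x^2 = 4 l1 D + (n^2 - 4 n) a^2]. *)
set x := 2 * l1%:Z * b - n * a.
have hx : x ^+ 2 = (n ^+ 2 - 4 * n) * a ^+ 2.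
  have -> : x ^+ 2 = 4 * l1%:Z *
     (l2%:Z * a ^+ 2 - l1%:Z * l2%:Z * a * b + l1%:Z * b ^+ 2)
     + (n ^+ 2 - 4 * n) * a ^+ 2 by rewrite /x /n PoszM; ring.
  by rewrite h; ring.
have ax : (a %| x)%Z by rewrite -(@dvdz_pexp2r _ _ 2) // hx dvdz_mull.
have /dvdzP[y hy] := ax.
have {hx} hx : y ^+ 2 = n ^+ 2 - 4 * n.
  have a20 : a ^+ 2 != 0 by rewrite expf_neq0 // gt_eqF.
  by apply: (mulIf a20); rewrite -hx hy; ring.
clear - n4 hx; rewrite /n in hx *; move: (l1 * l2)%N n4 hx => m m4 hx.
have : (`|y| <= m - 3)%N \/ (m - 2 <= `|y|)%N by lia.
have : `|y|%:Z ^+ 2 = y ^+ 2 by lia.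
rewrite hx; nia.
Qed.

(** * Vectors with nonpositive value *)

Lemma permissibleC l1 l2 a b :
  permissible l1 l2 (a, b) -> permissible l2 l1 (b, a).
Proof.
move=> [k [k0 [Pa [Pb [/= hA [hB h]]]]]].
exists k; split=> //; exists Pb, Pa; do 2!split=> //.
rewrite /= in h *; lia.
Qed.

(** The criterion for permissibility given by near-constant partitions of [a k]
    and constant partitions of [b k]. *)
Lemma permissible_near_constant (l1 l2 : nat) (a b k q e q' : int) :
  (0 < l1)%N -> (0 < l2)%N -> 0 < k -> 0 <= q -> 0 <= q + e -> 0 <= q' ->
  a * k = q * l1%:Z + e -> b * k = q' * l2%:Z ->
  k ^+ 2 * disc_form l1 l2 a b + l2%:Z * e ^+ 2 * (l1%:Z - 1)
    <= l1%:Z * l2%:Z * (2 - k) ->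
  permissible l1 l2 (a, b).
Proof.
move=> l10 l20 k0 q0 qe0 q'0 hA hB hD.
have [Pa [sA ssA]] := @near_constant_partition l1 (a * k) e q l10 q0 qe0 hA.
have [Pb [sB ssB]] :
  exists P : l2.-tuple nat, (part_size P)%:Z = b * k /\
    l2%:Z * \sum_(p <- P) p%:Z ^+ 2 = (b * k) ^+ 2 + 0 ^+ 2 * (l2%:Z - 1).
  by apply: (@near_constant_partition _ _ _ q'); rewrite ?addr0.
exists k; split=> //; exists Pa, Pb; do 2!split=> //=.
move: ssA ssB hD; rewrite /disc_form.
move: (\sum_(_ <- _) _) (\sum_(_ <- _) _) => T S ssA ssB hD.
have l12 : 0 < l1%:Z * l2%:Z by rewrite mulr_gt0.
rewrite -(pmulr_rge0 _ l12).
have -> : l1%:Z * l2%:Z * (a * b * k ^+ 2 - k - S - T + 2) =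
  l1%:Z * l2%:Z * (2 - k) + l1%:Z * l2%:Z * (a * b * k ^+ 2)
   - l2%:Z * (l1%:Z * S) - l1%:Z * (l2%:Z * T) by ring.
rewrite ssA ssB; lia.
Qed.

Lemma permissible_disc_form_le0 (l1 l2 : nat) (a b : int) :
  (4 <= l1 * l2)%N -> 0 < a -> 0 < b -> disc_form l1 l2 a b <= 0 ->
  permissible l1 l2 (a, b).
Proof.
move=> n4 a0 b0.
have [l10 l20] := @factors_gt0 _ _ n4.
rewrite le_eqVlt => /orP[/eqP D0|Dlt].
  have n4' := @disc_form_eq0 _ _ _ _ n4 a0 D0.
  have n4Z : l1%:Z * l2%:Z = 4 by rewrite -PoszM n4'.
  (* When [l1 l2 = 4], [l1 D] is the square of [2 a - l1 b]. *)
  have e1 : 2 * a = b * l1%:Z.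
    apply/eqP; rewrite -subr_eq0 -sqrf_eq0.
    have -> : (2 * a - b * l1%:Z) ^+ 2 = l1%:Z * disc_form l1 l2 a b
       + (4 - l1%:Z * l2%:Z) * (a ^+ 2 - l1%:Z * a * b).
      by rewrite /disc_form; ring.
    by rewrite D0 n4Z; apply/eqP; ring.
  have e2 : 2 * b = a * l2%:Z.
    have l1n0 : l1%:Z != 0 by lia.
    apply: (mulfI l1n0).
    by rewrite mulrCA [l1%:Z * b]mulrC -e1 [RHS]mulrCA n4Z; ring.
  by apply: (@permissible_near_constant _ _ _ _ 2 b 0 a) => //; rewrite ?D0; lia.
have n0 : 0 < l1%:Z * l2%:Z by rewrite mulr_gt0.
apply: (@permissible_near_constant _ _ _ _ (l1%:Z * l2%:Z)
  (a * l2%:Z) 0 (b * l1%:Z)) => //; nia.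
Qed.

(** * Vectors with positive value *)

(** The conditions defining the set A* besides positivity, with the equation
    [a^2 R(b/a) = 1 / l1] cleared of denominators.  Exchanging the roles of the
    two coordinates gives those of B*. *)
Definition boundary_vector (l1 l2 : nat) (a b : int) : Prop :=
  ((a = 1 %[mod l1%:Z])%Z \/ (a = -1 %[mod l1%:Z])%Z) /\
  (b = 0 %[mod l2%:Z])%Z /\ disc_form l1 l2 a b = l2%:Z.

Lemma eqmodP (x y d : int) : (x = y %[mod d])%Z <-> exists q, x = q * d + y.
Proof.
split=> [/eqP|[q ->]]; last by rewrite modzMDl.
by rewrite eqz_mod_dvd => /dvdzP[q hq]; exists q; rewrite -hq subrK.
Qed.

Lemma boundary_vectorP l1 l2 a b : boundary_vector l1 l2 a b <->
  exists q e q', [/\ (e = 1 \/ e = -1), a = q * l1%:Z + e, b = q' * l2%:Z &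
    disc_form l1 l2 a b = l2%:Z].
Proof.
rewrite /boundary_vector; split.
  case=> h [/eqmodP[q' hb] hD].
  by case: h => /eqmodP[q ha]; exists q; [exists 1|exists (-1)];
    exists q'; split=> //; [left|rewrite hb addr0|right|rewrite hb addr0].
case=> q [e [q' [he ha hb hD]]]; split; last first.
  by split=> //; apply/eqmodP; exists q'; rewrite addr0.
by case: he ha => -> ha; [left|right]; apply/eqmodP; exists q.
Qed.

Lemma boundary_vector_permissible l1 l2 a b : (0 < l1)%N -> (0 < l2)%N ->
  0 < a -> 0 < b -> boundary_vector l1 l2 a b -> permissible l1 l2 (a, b).
Proof.
move=> l10 l20 a0 b0 /boundary_vectorP[q [e [q' [he ha hb hD]]]].
have [q0 qe0] : 0 <= q /\ 0 <= q + e by case: he => he; split; nia.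
apply: (@permissible_near_constant _ _ _ _ 1 q e q') => //; rewrite ?mulr1 //.
- nia.
- by rewrite hD; case: he => ->; lia.
Qed.

Lemma boundary_vector_coprime l1 l2 a b : (0 < l2)%N ->
  boundary_vector l1 l2 a b -> coprimez a b.
Proof.
move=> l20 /boundary_vectorP[q [e [q' [he ha hb hD]]]].
(* With [b = q' l2], the equation [D = l2] reads
   [a (a - l1 b) + b (l1 q') = 1]. *)
apply/coprimezP; exists (a - l1%:Z * b, l1%:Z * q') => /=.
have l20' : l2%:Z != 0 by lia.
apply: (mulfI l20'); rewrite mulr1 -[in RHS]hD /disc_form hb; ring.
Qed.

(** The inequality for [k = 1] when [b] is divisible by [l2] and [a] is not
    divisible by [l1]: for [2 <= r <= l1 - 2] the term [r (l1 - r)] already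
    reaches [l1]. *)
Lemma boundary_vector_of_small (l1 l2 r : nat) (q a b' : int) :
  (0 < l2)%N -> (0 < r < l1)%N -> a = q * l1%:Z + r%:Z ->
  0 < disc_form l1 l2 a (b' * l2%:Z) ->
  disc_form l1 l2 a (b' * l2%:Z) + l2%:Z * (r%:Z * (l1%:Z - r%:Z))
    <= l1%:Z * l2%:Z ->
  boundary_vector l1 l2 a (b' * l2%:Z).
Proof.
move=> l20 hr ha.
have -> : disc_form l1 l2 a (b' * l2%:Z) =
  l2%:Z * (a ^+ 2 - l1%:Z * l2%:Z * a * b' + l1%:Z * l2%:Z * b' ^+ 2).
  by rewrite /disc_form; ring.
set E := a ^+ 2 - _ + _.
have l2p : 0 < l2%:Z by lia.
rewrite pmulr_rgt0 // => E0.
rewrite -mulrDr [leRHS]mulrC ler_pM2l // => hE.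
have hr' : r = 1%N \/ r = l1.-1.
  have [] : r = 1%N \/ r = l1.-1 \/ (2 <= r /\ r + 2 <= l1)%N by lia.
    by left.
  case; first by right.
  nia.
have E1 : E = 1 by case: hr' => hr'; rewrite hr' in hE; nia.
apply/boundary_vectorP.
have [e [q2 [he ha2]]] : exists e q2 : int, (e = 1 \/ e = -1) /\ a = q2 * l1%:Z + e.
  case: hr' => hr'; first by exists 1, q; rewrite ha hr'; split=> //; left.
  by exists (-1), (q + 1); split; [right|rewrite ha; lia].
exists q2, e, b'; split=> //.
transitivity (l2%:Z * E); first by rewrite /E /disc_form; ring.
by rewrite E1 mulr1.
Qed.

Lemma eqmod0_eqmod1 (l : nat) (x : int) : (x = 0 %[mod l%:Z])%Z ->
  (x = 1 %[mod l%:Z])%Z \/ (x = -1 %[mod l%:Z])%Z -> l = 1%N.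
Proof.
move=> /eqmodP[p hp] h; apply/eqP; rewrite -dvdn1.
suff : (l%:Z %| 1)%Z by rewrite dvdzE.
case: h => /eqmodP[r hr]; apply/dvdzP; [exists (p - r)|exists (r - p)];
  by rewrite mulrBl; lia.
Qed.

Lemma boundary_vector_disjoint (l1 l2 : nat) (a b : int) : (4 <= l1 * l2)%N ->
  boundary_vector l1 l2 a b -> boundary_vector l2 l1 b a -> False.
Proof.
move=> n4 [ha [hb _]] [hb' [ha' _]]; move: n4.
by rewrite (@eqmod0_eqmod1 _ _ ha' ha) (@eqmod0_eqmod1 _ _ hb hb').
Qed.

(** A permissible vector of the open quadrant with [D > 0] is permissible with
    [k = 1], and the cases are those of the vanishing of the residues [r] of [a]
    modulo [l1] and [s] of [b] modulo [l2]. *)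
Lemma permissible_cases (l1 l2 : nat) (a b : int) :
  (4 <= l1 * l2)%N -> 0 < a -> 0 < b -> permissible l1 l2 (a, b) ->
  [\/ boundary_vector l1 l2 a b, boundary_vector l2 l1 b a |
      disc_form l1 l2 a b <= 0].
Proof.
move=> n4 a0 b0 [k [k0 [Pa [Pb [/= hA [hB h]]]]]].
have [l10 l20] := @factors_gt0 _ _ n4.
have [?|D0] := leP (disc_form l1 l2 a b) 0; first by constructor 3.
have [q [r [rl1 [hqr hSA]]]] := @partition_sum_sqr_ge l1 Pa l10.
have [q' [s [sl2 [hqs hSB]]]] := @partition_sum_sqr_ge l2 Pb l20.
rewrite hA in hqr hSA; rewrite hB in hqs hSB; clear hA hB.
have hD : k ^+ 2 * disc_form l1 l2 a b + l2%:Z * (r%:Z * (l1%:Z - r%:Z))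
    + l1%:Z * (s%:Z * (l2%:Z - s%:Z)) <= l1%:Z * l2%:Z * (2 - k).
  move: h hSA hSB; set SA := \sum_(p <- Pa) _; set SB := \sum_(p <- Pb) _.
  move: SA SB => SA SB h hSA hSB.
  have l12 : 0 <= l1%:Z * l2%:Z by rewrite mulr_ge0.
  have := mulr_ge0 l12 h.
  have := ler_wpM2l (isT : 0 <= l2%:Z) hSA.
  have := ler_wpM2l (isT : 0 <= l1%:Z) hSB.
  rewrite /disc_form; lia.
clear h hSA hSB Pa Pb.
have hr0 : 0 <= l2%:Z * (r%:Z * (l1%:Z - r%:Z)) by rewrite !mulr_ge0 //; lia.
have hs0 : 0 <= l1%:Z * (s%:Z * (l2%:Z - s%:Z)) by rewrite !mulr_ge0 //; lia.
(* For [k >= 2] the left side of [hD] is positive and its right side is not. *)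
have k1 : k = 1.
  have [k2|] := leP 2 k; last by lia.
  have : 0 < k ^+ 2 * disc_form l1 l2 a b by rewrite mulr_gt0 // exprn_gt0.
  have : 0 <= l1%:Z * l2%:Z * (k - 2) by rewrite !mulr_ge0 //; lia.
  lia.
rewrite k1 expr1n mul1r in hD; rewrite k1 mulr1 in hqr; rewrite k1 mulr1 in hqs.
have {}hD : disc_form l1 l2 a b + l2%:Z * (r%:Z * (l1%:Z - r%:Z))
    + l1%:Z * (s%:Z * (l2%:Z - s%:Z)) <= l1%:Z * l2%:Z by lia.
have [r0|r0] := posnP r; have [s0|s0] := posnP s.
- (* Both residues vanish: [D] is [l1 l2] times an integer, which must be 1. *)
  rewrite r0 addr0 in hqr; rewrite s0 addr0 in hqs.
  have q0 : 0 < q by rewrite hqr in a0; move: a0; rewrite pmulr_lgt0.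
  have q'0 : 0 < q' by rewrite hqs in b0; move: b0; rewrite pmulr_lgt0.
  have l12 : 0 < l1%:Z * l2%:Z by rewrite mulr_gt0.
  have DE : disc_form l1 l2 a b = l1%:Z * l2%:Z *
      (l1%:Z * q ^+ 2 - l1%:Z * l2%:Z * q * q' + l2%:Z * q' ^+ 2).
    by rewrite /disc_form hqr hqs; ring.
  have F1 : l1%:Z * q ^+ 2 - l1%:Z * l2%:Z * q * q' + l2%:Z * q' ^+ 2 = 1.
    have : disc_form l1 l2 a b <= l1%:Z * l2%:Z * 1 by lia.
    by move: D0; rewrite DE ler_pM2l // pmulr_rgt0 //; lia.
  rewrite F1 mulr1 in DE.
  have [l11|l11] := leqP l1 1.
    have e1 : l1 = 1%N by lia.
    (* Any residue is allowed modulo 1; [a = (q - 1) + 1] fits the required shape. *)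
    constructor 1; apply/boundary_vectorP; exists (q - 1), 1, q'.
    by rewrite DE hqr hqs e1; split=> //; [left|ring|ring].
  have [l21|l21] := leqP l2 1.
    have e1 : l2 = 1%N by lia.
    constructor 2; apply/boundary_vectorP; exists (q' - 1), 1, q.
    by rewrite disc_formC DE hqr hqs e1; split=> //; [left|ring|ring].
  by have /eqP[] := @no_unit_value _ _ _ _ l11 l21 q0 q'0.
- constructor 2; rewrite disc_formC in hD D0.
  rewrite r0 addr0 in hqr; rewrite hqr in hD D0 *.
  by apply: (@boundary_vector_of_small l2 l1 s q') => //; [lia|lia].
- constructor 1; rewrite s0 addr0 in hqs; rewrite hqs in hD D0 *.
  by apply: (@boundary_vector_of_small l1 l2 r q) => //; [lia|lia].
(* Both residues are nonzero, so [l1, l2 >= 2] and [l1 + l2 <= l1 l2]. *)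
exfalso.
have h1 : l2%:Z * (l1%:Z - 1) <= l2%:Z * (r%:Z * (l1%:Z - r%:Z)).
  rewrite ler_wpM2l //; nia.
have h2 : l1%:Z * (l2%:Z - 1) <= l1%:Z * (s%:Z * (l2%:Z - s%:Z)).
  rewrite ler_wpM2l //; nia.
have : 0 < (l1%:Z - 1) * (l2%:Z - 1) by rewrite mulr_gt0 //; lia.
lia.
Qed.

(** * The quadratic form and the roots of [Rquad] *)

Lemma disc_form_Rquad (R : realType) (l1 l2 : nat) (a b : int) :
  (0 < l1)%N -> (0 < l2)%N -> 0 < a ->
  a%:~R ^+ 2 * Rquad l1 l2 (slope R (a, b)) =
    (disc_form l1 l2 a b)%:~R / (l1%:R * l2%:R) :> R.
Proof.
move=> l10 l20 a0; have aR : a%:~R != 0 :> R by rewrite intr_eq0 gt_eqF.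
have l1R : l1%:R != 0 :> R by rewrite pnatr_eq0 -lt0n.
have l2R : l2%:R != 0 :> R by rewrite pnatr_eq0 -lt0n.
rewrite /Rquad /slope /disc_form /= rmorphD rmorphB !rmorphM /=.
by rewrite -!pmulrn; field; rewrite aR l1R l2R.
Qed.

Lemma mul_subr_le0 (R : realDomainType) (x y z : R) : x <= y ->
  ((z - x) * (z - y) <= 0) = (x <= z <= y).
Proof.
move=> xy; apply/idP/andP => [h|[xz zy]]; last by rewrite mulr_ge0_le0; lra.
have [zx|xz] := ltP z x.
  have : 0 < (z - x) * (z - y) by rewrite nmulr_rgt0; lra.
  by rewrite ltNge h.
split=> //; have [yz|//] := ltP y z.
have : 0 < (z - x) * (z - y) by rewrite pmulr_rgt0; lra.
by rewrite ltNge h.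
Qed.

Lemma Rquad_le0 (R : realType) (l1 l2 : nat) (z : R) : (4 <= l1 * l2)%N ->
  (Rquad l1 l2 z <= 0) = (xi_minus R l1 l2 <= z <= xi_plus R l1 l2).
Proof.
move=> n4; have [l10 l20] := @factors_gt0 _ _ n4.
rewrite /xi_minus /xi_plus.
have l1R : (0 : R) < l1%:R by rewrite ltr0n.
have l2R : (0 : R) < l2%:R by rewrite ltr0n.
have n4R : (4 : R) <= l1%:R * l2%:R by rewrite -natrM ler_nat.
set s := Num.sqrt _.
have s0 : 0 <= s by exact: sqrtr_ge0.
have s2 : s ^+ 2 = 1 - 4 / (l1%:R * l2%:R).
  by rewrite sqr_sqrtr // subr_ge0 ler_pdivrMr ?mul1r // mulr_gt0.
have -> : Rquad l1 l2 z =
    l2%:R^-1 * ((z - l2%:R / 2 * (1 - s)) * (z - l2%:R / 2 * (1 + s))).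
  have -> : (z - l2%:R / 2 * (1 - s)) * (z - l2%:R / 2 * (1 + s)) =
    z ^+ 2 - l2%:R * z + (l2%:R / 2) ^+ 2 * (1 - s ^+ 2) by field.
  by rewrite s2 /Rquad; field; rewrite !gt_eqF.
rewrite pmulr_rle0 ?invr_gt0 // mul_subr_le0 //.
by rewrite ler_pM2l ?divr_gt0 //; lra.
Qed.

(** With [(m, m')] equal to [(l1, l2)] or [(l2, l1)], the equations of A* and B*. *)
Lemma Rquad_eq_inv (R : realType) (l1 l2 m m' : nat) (a b : int) :
  (0 < l1)%N -> (0 < l2)%N -> 0 < a -> (m * m' = l1 * l2)%N ->
  (a%:~R ^+ 2 * Rquad l1 l2 (slope R (a, b)) = m%:R^-1) <->
  disc_form l1 l2 a b = m'%:Z.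
Proof.
move=> l10 l20 a0 mm'; rewrite disc_form_Rquad // -natrM -mm' natrM.
have : (m%:R * m'%:R) != 0 :> R.
  by rewrite -natrM pnatr_eq0 -lt0n mm' muln_gt0 l10.
rewrite mulf_eq0 negb_or => /andP[mR m'R].
have -> : m%:R^-1 = (m'%:Z)%:~R / (m%:R * m'%:R) :> R.
  by rewrite -pmulrn; field; rewrite mR m'R.
split=> [|-> //]; have nz : (m%:R * m'%:R)^-1 != 0 :> R.
  by rewrite invr_neq0 // mulf_neq0.
by move/(mulIf nz)/intr_inj.
Qed.

Lemma AstarP (R : realType) (l1 l2 : nat) (a b : int) :
  (0 < l1)%N -> (0 < l2)%N ->
  Astar R l1 l2 (a, b) <-> [/\ 0 < a, 0 < b & boundary_vector l1 l2 a b].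
Proof.
move=> l10 l20; split.
  case=> -[/= a0 b0] [ha [hb hD]]; split=> //; do 2!split=> //.
  by apply/(@Rquad_eq_inv R _ _ l1).
case=> a0 b0 [ha [hb hD]]; do 3!split=> //.
by apply/(@Rquad_eq_inv R _ _ l1 l2).
Qed.

Lemma BstarP (R : realType) (l1 l2 : nat) (a b : int) :
  (0 < l1)%N -> (0 < l2)%N ->
  Bstar R l1 l2 (a, b) <-> [/\ 0 < a, 0 < b & boundary_vector l2 l1 b a].
Proof.
move=> l10 l20; rewrite /boundary_vector disc_formC; split.
  case=> -[/= a0 b0] [ha [hb hD]]; split=> //; do 2!split=> //.
  by apply/(@Rquad_eq_inv R _ _ l2); rewrite // mulnC.
case=> a0 b0 [ha [hb hD]]; do 3!split=> //.
by apply/(@Rquad_eq_inv R _ _ l2 l1); rewrite // mulnC.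
Qed.

Lemma between_rootsP (R : realType) (l1 l2 : nat) (a b : int) :
  (4 <= l1 * l2)%N ->
  between_roots R l1 l2 (a, b) <->
  [/\ coprimez a b, 0 < a, 0 < b & disc_form l1 l2 a b <= 0].
Proof.
move=> n4; have [l10 l20] := @factors_gt0 _ _ n4.
have E : 0 < a -> (xi_minus R l1 l2 <= slope R (a, b) <= xi_plus R l1 l2)
    = (disc_form l1 l2 a b <= 0).
  move=> a0; rewrite -Rquad_le0 //.
  have a2 : (0 : R) < a%:~R ^+ 2 by rewrite exprn_gt0 // ltr0z.
  rewrite -(pmulr_rle0 _ a2) disc_form_Rquad // pmulr_lle0 ?lerz0 //.
  by rewrite invr_gt0 mulr_gt0 // ltr0n.
split=> [[cab [[/= a0 b0]]]|[cab a0 b0 hD]]; first by rewrite E.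
by do 2!split=> //; rewrite E.
Qed.

Theorem theorem5 (R : realType) (l1 l2 : nat)
  (hl1 : (0 < l1)%N) (hl2 : (0 < l2)%N)
  (hl : (l1, l2) \notin [:: (1, 1); (1, 2); (2, 1); (1, 3); (3, 1)]%N) :
  permissible_vectors l1 l2
    = Astar R l1 l2 `|` Bstar R l1 l2 `|` between_roots R l1 l2 /\
  Astar R l1 l2 `&` Bstar R l1 l2 = set0 /\
  Astar R l1 l2 `&` between_roots R l1 l2 = set0 /\
  Bstar R l1 l2 `&` between_roots R l1 l2 = set0.
Proof.
have n4 : (4 <= l1 * l2)%N.
  case: l1 l2 hl1 hl2 hl => [|[|[|[|m]]]] // [|[|[|[|n]]]] //= _ _ _; nia.
split; last split; last split.
- apply/seteqP; split=> -[a b] /=.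
    move=> [cab [[/= a0 b0] hP]].
    case: (permissible_cases _ _ _ _ n4 a0 b0 hP) => h.
    + by left; left; apply/AstarP.
    + by left; right; apply/BstarP.
    + by right; apply/between_rootsP.
  case=> [[/AstarP|/BstarP]|/between_rootsP].
  + move=> /(_ hl1 hl2)[a0 b0 h]; split; last split=> //.
      exact: boundary_vector_coprime hl2 h.
    exact: boundary_vector_permissible h.
  + move=> /(_ hl1 hl2)[a0 b0 h]; split; last split=> //.
      by rewrite /primitive coprimez_sym; exact: boundary_vector_coprime hl1 h.
    by apply: permissibleC; exact: boundary_vector_permissible h.
  + move=> /(_ n4)[cab a0 b0 h]; split=> //; split=> //.
    exact: permissible_disc_form_le0.
- apply/seteqP; split=> // -[a b] [/AstarP hA /BstarP hB].
  have [_ _ h1] := hA hl1 hl2; have [_ _ h2] := hB hl1 hl2.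
  exact: boundary_vector_disjoint h1 h2.
- apply/seteqP; split=> // -[a b] [/AstarP hA /between_rootsP hB].
  have [_ _ [_ [_ h1]]] := hA hl1 hl2; have [_ _ _ h2] := hB n4.
  by move: h2; rewrite h1; lia.
apply/seteqP; split=> // -[a b] [/BstarP hA /between_rootsP hB].
have [_ _ [_ [_ h1]]] := hA hl1 hl2; have [_ _ _ h2] := hB n4.
by move: h2; rewrite disc_formC h1; lia.
Qed.
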